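(* For a positive integer $n$, let $a(n)$ denote the number of isomorphism classes of AG-groups with $n$ elements. If $p>2$ is a prime, then $a(p)=2$ and $a(p^2)=5$. For $p=2$, $a(2)=1$ and $a(4)=4$.
   Context: A groupoid $(G,\cdot)$ is a set $G$ with a single binary operation $\cdot$ (no axioms assumed). An AG-group (Abel-Grassmann group) is a groupoid $(G,\cdot)$ such that: $(a\cdot b)\cdot c=(c\cdot b)\cdot a$ for all $a,b,c\in G$; there exists a left unit $e$, i.e. an element with $e\cdot a=a$ for every $a\in G$; and for every $a\in G$ there exists a unique $a^{-1}\in G$ such that $a\cdot a^{-1}=a^{-1}\cdot a=e$. An isomorphism of AG-groups is a bijection preserving the operations of the AG-group (the binary operation $\cdot$, inverses ${}^{-1}$ and the left unit $e$). *)

(* Defs.v *)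
From mathcomp Require Import all_boot.

Set Implicit Arguments.
Unset Strict Implicit.
Unset Printing Implicit Defensive.

Definition is_AG_group_op (T : Type) (op : T -> T -> T) : Prop :=
  (forall a b c, op (op a b) c = op (op c b) a) /\
  exists e, (forall a, op e a = a) /\
    forall a, exists! b, op a b = e /\ op b a = e.

(* AG-group isomorphisms preserve the product, the inverse and the left
   unit, so all three are part of the structure; [AG_group_of] and
   [AG_group_opP] below show that the last two are determined by the product. *)
Definition ag_data (T : finType) : Type :=
  {ffun T * T -> T} * {ffun T -> T} * T.

Section Structure.
Variables (T : finType) (G : ag_data T).

Definition ag_mul (a b : T) : T := G.1.1 (a, b).
Definition ag_inv (a : T) : T := G.1.2 a.
Definition ag_unit : T := G.2.

(* The last clause says that [ag_inv a] is the unique two-sided inverse of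
   [a]; see [AG_groupP]. *)
Definition AG_group : bool :=
  [&& [forall a, forall b, forall c,
         ag_mul (ag_mul a b) c == ag_mul (ag_mul c b) a],
      [forall a, ag_mul ag_unit a == a] &
      [forall a, forall b,
         ((ag_mul a b == ag_unit) && (ag_mul b a == ag_unit))
           == (b == ag_inv a)]].

Lemma AG_groupP :
  reflect [/\ forall a b c, ag_mul (ag_mul a b) c = ag_mul (ag_mul c b) a,
              forall a, ag_mul ag_unit a = a
            & forall a, unique (fun b => ag_mul a b = ag_unit /\
                                         ag_mul b a = ag_unit) (ag_inv a)]
          AG_group.
Proof.
apply: (iffP and3P) => -[h1 h2 h3]; split.
- by move=> a b c; move/forallP: h1 => /(_ a)/forallP/(_ b)/forallP/(_ c)/eqP.
- by move=> a; move/forallP: h2 => /(_ a)/eqP.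
- move=> a; have h b := eqP (forallP (forallP h3 a) b); split.
    by move: (h (ag_inv a)); rewrite eqxx => /andP[/eqP-> /eqP->].
  by move=> b [hl hr]; move: (h b); rewrite hl hr !eqxx => /esym/eqP.
- by apply/forallP=> a; apply/forallP=> b; apply/forallP=> c; rewrite h1.
- by apply/forallP=> a; rewrite h2.
- apply/forallP=> a; apply/forallP=> b; have [[hl hr] hu] := h3 a.
  apply/eqP; apply/andP/eqP => [[/eqP bl /eqP br]|->]; last by rewrite hl hr.
  by rewrite (hu b).
Qed.

End Structure.

Section Isomorphism.
Variables (T U : finType) (G : ag_data T) (H : ag_data U).

Definition AG_iso (f : T -> U) : Prop :=
  [/\ bijective f,
      forall a b, f (ag_mul G a b) = ag_mul H (f a) (f b),
      forall a, f (ag_inv G a) = ag_inv H (f a)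
    & f (ag_unit G) = ag_unit H].

Definition AG_isog : bool :=
  [exists f : {ffun T -> U},
    [&& injectiveb f && [forall y, exists x, f x == y],
        [forall a, forall b, f (ag_mul G a b) == ag_mul H (f a) (f b)],
        [forall a, f (ag_inv G a) == ag_inv H (f a)]
      & f (ag_unit G) == ag_unit H]].

Lemma AG_isogP : reflect (exists f, AG_iso f) AG_isog.
Proof.
apply: (iffP existsP) => -[f].
  case/and4P=> /andP[/injectiveP finj /forallP fsurj] /forallP hM /forallP hV.
  move/eqP=> h1; exists f; split=> //.
  - have ex y : exists x, f x == y by apply/existsP.
    exists (fun y => xchoose (ex y)) => x; last exact: eqP (xchooseP (ex x)).
    exact/finj/eqP/(xchooseP (ex (f x))).
  - by move=> a b; apply/eqP; move/forallP: (hM a).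
  - by move=> a; apply/eqP.
case=> fbij hM hV h1; exists (finfun f); apply/and4P; split.
- apply/andP; split.
    by apply/injectiveP=> x y; rewrite !ffunE; apply: bij_inj.
  case: fbij => g _ gK; apply/forallP=> y.
  by apply/existsP; exists (g y); rewrite ffunE gK.
- by apply/forallP=> a; apply/forallP=> b; rewrite !ffunE hM.
- by apply/forallP=> a; rewrite !ffunE hV.
- by rewrite ffunE h1.
Qed.

End Isomorphism.

Lemma AG_isog_equiv (T : finType) :
  equivalence_rel (@AG_isog T T).
Proof.
have refl G : @AG_isog T T G G.
  by apply/AG_isogP; exists id; split=> //; exists id.
have sym G H : @AG_isog T T G H -> AG_isog H G.
  case/AG_isogP=> f [[g fK gK] hM hV h1]; apply/AG_isogP; exists g; split.
  - by exists f.
  - by move=> a b; apply: (can_inj fK); rewrite hM !gK.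
  - by move=> a; apply: (can_inj fK); rewrite hV !gK.
  - by apply: (can_inj fK); rewrite h1 gK.
have trans G H K : @AG_isog T T G H -> @AG_isog T T H K -> AG_isog G K.
  case/AG_isogP=> f [fb fM fV f1] /AG_isogP[g [gb gM gV g1]].
  apply/AG_isogP; exists (g \o f); split=> /=.
  - exact: bij_comp.
  - by move=> a b; rewrite fM gM.
  - by move=> a; rewrite fV gV.
  - by rewrite f1 g1.
move=> G H K; split=> // GH; apply/idP/idP; last exact: trans.
by apply: trans; apply: sym.
Qed.

(* [num_AG_groups n] counts isomorphism classes of structures carried by
   ['I_n]; by [AG_group_transport] each AG-group with n elements is isomorphic
   to one of these. *)
Definition num_AG_groups (n : nat) : nat :=
  #|equivalence_partition (@AG_isog 'I_n 'I_n)
      [set G : ag_data 'I_n | AG_group G]|.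

Lemma AG_group_opP (T : finType) (G : ag_data T) :
  AG_group G -> is_AG_group_op (ag_mul G).
Proof.
case/AG_groupP=> h1 h2 h3; split=> //; exists (ag_unit G); split=> // a.
by exists (ag_inv G a).
Qed.

Lemma AG_group_of (T : finType) (op : T -> T -> T) :
  is_AG_group_op op ->
  exists! G : ag_data T, AG_group G /\ forall a b, ag_mul G a b = op a b.
Proof.
case=> h1 [e [h2 h3]].
have ex a : exists b, (op a b == e) && (op b a == e).
  by have [b [[hl hr] _]] := h3 a; exists b; rewrite hl hr eqxx.
pose inv a := xchoose (ex a).
have invP a : op a (inv a) = e /\ op (inv a) a = e.
  by have /andP[/eqP-> /eqP->] := xchooseP (ex a).
have invU a b : op a b = e /\ op b a = e -> inv a = b.
  by have [c [_ cU]] := h3 a; move=> /cU <-; apply/esym/cU.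
exists ([ffun x => op x.1 x.2], finfun inv, e); split.
  split=> [|a b]; last by rewrite /ag_mul ffunE.
  apply/AG_groupP; split=> [a b c|a|a]; rewrite /ag_mul /ag_inv /ag_unit /=.
  - by rewrite !ffunE /= h1.
  - by rewrite ffunE.
  - by split=> [|b]; rewrite !ffunE; [apply: invP | apply: invU].
move=> [[m i] e'] [/AG_groupP[_ k2 k3] km].
rewrite /ag_unit /ag_inv /= in k2 k3.
have ee' : e = e'.
  have e'e : op e' e = e by rewrite -km k2.
  by have := h1 e e e'; rewrite !h2 e'e h2.
rewrite -ee' in k2 k3 km *; congr (_, _, _); apply/ffunP.
  by case=> a b; rewrite ffunE /= -km.
move=> a; rewrite ffunE; apply: invU.
by have [[]] := k3 a; rewrite !km.
Qed.

Lemma AG_group_transport (n : nat) (T : finType) (G : ag_data T) :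
  #|T| = n -> AG_group G ->
  exists2 H : ag_data 'I_n, AG_group H & AG_isog G H.
Proof.
move=> <- /AG_groupP[h1 h2 h3].
pose f := @enum_rank T; pose g := @enum_val T T.
have fK : cancel f g by exact: enum_rankK.
have gK : cancel g f by exact: enum_valK.
pose H : ag_data 'I_#|T| :=
  ([ffun x => f (ag_mul G (g x.1) (g x.2))],
   [ffun x => f (ag_inv G (g x))], f (ag_unit G)).
have HM a b : ag_mul H a b = f (ag_mul G (g a) (g b)) by rewrite /ag_mul ffunE.
have HV a : ag_inv H a = f (ag_inv G (g a)) by rewrite /ag_inv ffunE.
have H1 : ag_unit H = f (ag_unit G) by [].
exists H.
  apply/AG_groupP; split=> [a b c|a|a].
  - by rewrite !HM !fK h1.
  - by rewrite HM H1 fK h2 gK.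
  - rewrite HV H1; have [[hl hr] hu] := h3 (g a); split.
      by rewrite !HM !fK hl hr.
    move=> b; rewrite !HM => -[/(can_inj fK) bl /(can_inj fK) br].
    by rewrite (hu (g b)) // gK.
apply/AG_isogP; exists f; split=> [|a b|a|//].
- by exists g.
- by rewrite HM !fK.
- by rewrite HV fK.
Qed.

(* Main.v *)
(* In an AG-group, a + b := (a . e) . b is an abelian group law with zero e,
   s a := a . e is an automorphism with s (s a) = a, and a . b = s a + b.
   So AG-groups with n elements correspond, up to isomorphism, to pairs (V, s)
   of an abelian group of order n and an automorphism s with s^2 = 1.
   If n is odd and s is neither the identity nor the inversion, then V contains
   a nontrivial fixed element x and a nontrivial inverted element y, and
   <x> and <y> meet trivially. For n = p this is impossible, and for n = p^2
   it forces V = <x> x <y> with both factors of order p; this gives 2 classes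
   for p and 2 + 2 + 1 for p^2. For n = 4 the only nontrivial involutory
   automorphisms are the inversion of Z/4 and, up to conjugacy, the swap of
   the two factors of Z/2 x Z/2. *)
Require Import Defs.
From HB Require Import structures.
From mathcomp Require Import all_boot.
From mathcomp Require Import all_fingroup all_solvable finalg zmodp.

Set Implicit Arguments.
Unset Strict Implicit.
Unset Printing Implicit Defensive.

Import GroupScope.

(** * Counting isomorphism classes by a list of representatives *)

Lemma AG_isog_sym (T U : finType) (G : ag_data T) (H : ag_data U) :
  AG_isog G H -> AG_isog H G.
Proof.
case/AG_isogP=> f [[g fK gK] fM fV f1]; apply/AG_isogP; exists g; split.
- by exists f.
- by move=> a b; apply: (can_inj fK); rewrite fM !gK.
- by move=> a; apply: (can_inj fK); rewrite fV !gK.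
- by apply: (can_inj fK); rewrite f1 gK.
Qed.

Lemma AG_isog_trans (T U V : finType)
    (G : ag_data T) (H : ag_data U) (K : ag_data V) :
  AG_isog G H -> AG_isog H K -> AG_isog G K.
Proof.
case/AG_isogP=> f [fb fM fV f1] /AG_isogP[g [gb gM gV g1]].
apply/AG_isogP; exists (g \o f); split=> /=; first exact: bij_comp.
- by move=> a b; rewrite fM gM.
- by move=> a; rewrite fV gV.
- by rewrite f1 g1.
Qed.

Lemma all_has_ex (T : Type) (a b : pred T) (s : seq T) :
  all a s -> has b s -> exists2 x, a x & b x.
Proof.
by elim: s => //= x s IHs /andP[ax sa] /orP[bx|/(IHs sa)//]; exists x.
Qed.

(* The representatives may live on different carriers, so that each of them
   can be given in its most natural form. *)
Lemma num_AG_groups_size (n : nat) (s : seq {T : finType & ag_data T}) :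
    all (fun x : {T : finType & ag_data T} =>
           (#|{: tag x}| == n) && AG_group (tagged x)) s ->
    pairwise (fun x y : {T : finType & ag_data T} =>
                ~~ AG_isog (tagged x) (tagged y)) s ->
    (forall G : ag_data 'I_n, AG_group G ->
       has (fun x : {T : finType & ag_data T} => AG_isog (tagged x) G) s) ->
  num_AG_groups n = size s.
Proof.
move=> sAG sI sC.
(* [c x] is the block of the partition formed by the copies of [x] on ['I_n]. *)
pose c (x : {T : finType & ag_data T}) :=
  [set H : ag_data 'I_n | AG_group H && AG_isog (tagged x) H].
have cP (x : {T : finType & ag_data T}) :
    (#|{: tag x}| == n) && AG_group (tagged x) ->
    exists2 H : ag_data 'I_n, AG_group H & AG_isog (tagged x) H.
  by case/andP=> /eqP cx; apply: AG_group_transport.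
have cE (x : {T : finType & ag_data T}) (G : ag_data 'I_n) :
    AG_isog (tagged x) G ->
  c x = [set H in [set G | AG_group G] | AG_isog G H].
  move=> xG; apply/setP=> H; rewrite !inE; congr (_ && _).
  by apply/idP/idP; apply: AG_isog_trans => //; apply: AG_isog_sym.
have c_uniq : uniq (map c s).
  rewrite uniq_pairwise pairwise_map.
  (* A copy [H] of [x] lies in [c x]; if it lay in [c y] as well, [x] and [y] would be
     isomorphic. *)
  apply: (sub_in_pairwise _ sAG sI) => x y /cP[H AH xH] _ /=.
  apply: contraNneq => /setP/(_ H); rewrite !inE AH xH => /esym yH.
  exact: AG_isog_trans xH (AG_isog_sym yH).
rewrite /num_AG_groups -(size_map c); move/card_uniqP: c_uniq => <-.
apply: eq_card => X; rewrite -[RHS]has_pred1 has_map.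
apply/imsetP/idP => [[G]|].
  rewrite inE => AG ->; have := sC G AG; apply: sub_has => x xG /=.
  by rewrite (cE _ G).
case/(all_has_ex sAG)=> x /cP[H AH xH] /eqP cX.
by exists H; rewrite ?inE // -cX (cE _ H).
Qed.

(** * From an abelian group with an involution to an AG-group *)

Section Twist.
Variables (gT : finGroupType) (s : gT -> gT).

Definition involutory_aut : Prop :=
  [/\ abelian [set: gT], {morph s : x y / x * y} & involutive s].

Definition twist : ag_data gT :=
  ([ffun x => s x.1 * x.2], [ffun x => (s x)^-1], 1).

Lemma twistM x y : ag_mul twist x y = s x * y.
Proof. by rewrite /ag_mul ffunE. Qed.

Hypothesis autS : involutory_aut.

Lemma twist_mulC (x y : gT) : x * y = y * x.
Proof. by case: autS => cG _ _; apply: (centsP cG); rewrite inE. Qed.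

Lemma twist1 : s 1 = 1.
Proof. by case: autS => _ sM _; apply: (mulgI (s 1)); rewrite -sM !mulg1. Qed.

Lemma twistV x : s x^-1 = (s x)^-1.
Proof.
by case: autS => _ sM _; apply: (mulgI (s x)); rewrite -sM !mulgV twist1.
Qed.

Lemma twistX x n : s (x ^+ n) = s x ^+ n.
Proof.
case: autS => _ sM _; elim: n => [|n IHn]; first by rewrite twist1.
by rewrite !expgS sM IHn.
Qed.

(** Since s is an involution, (a . b) . c unfolds to a * s b * c, which is symmetric in a and c when
    the group is abelian. *)
Lemma AG_group_twist : AG_group twist.
Proof.
have [_ sM sK] := autS; apply/AG_groupP; split=> [a b c|a|a].
- by rewrite !twistM !sM !sK -mulgA [RHS]twist_mulC [s b * c]twist_mulC.
- by rewrite twistM twist1 mul1g.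
rewrite /ag_inv ffunE; split=> [|b []]; rewrite !twistM.
  by rewrite twistV sK mulgV mulVg.
by move=> /(canRL (mulKg _)); rewrite mulg1.
Qed.

End Twist.

(* An alias depending on the proof that [G] is an AG-group, so that the group
   structure declared below does not become canonical on every [finType]. *)
Definition additive_of (T : finType) (G : ag_data T) (_ : AG_group G) : Type :=
  T.

(** * From an AG-group back to an abelian group with an involution *)

Section Reduction.
Variables (T : finType) (G : ag_data T).
Hypothesis AG : AG_group G.

Let m := ag_mul G.
Let e := ag_unit G.

Let mAC a b c : m (m a b) c = m (m c b) a.
Proof. by case/AG_groupP: AG. Qed.

Let m1x a : m e a = a.
Proof. by case/AG_groupP: AG. Qed.

(** Write a as e . a and apply [mAC] three times: (e . a) . (b . c) = ((b . c) . a) . e = ((a . c) .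
    b) . e = (e . b) . (a . c). *)
Let mCA a b c : m a (m b c) = m b (m a c).
Proof. by rewrite -{1}[a]m1x mAC [m (m b c) a]mAC mAC m1x. Qed.

Let add a b := m (m a e) b.

Let meK a : m (m a e) e = a.
Proof. by rewrite mAC !m1x. Qed.

Let addC a b : add a b = add b a.
Proof. exact: mAC. Qed.

Let add_e a b : m (add a b) e = m b (m a e).
Proof. by rewrite /add mAC m1x. Qed.

Let addA : associative add.
Proof.
(* The two sides become (a . (b . e)) . c and (b . (a . e)) . c, which agree by [mCA]. *)
move=> a b c; rewrite [LHS]addC {1}/add [RHS]/add !add_e mAC.
by rewrite [m a _]mCA.
Qed.

Let add1x : left_id e add.
Proof. by move=> a; rewrite /add !m1x. Qed.

(** The negative of a is a^-1 . e: multiplying by e on the right twice changes nothing, which leaves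
    a^-1 . a = e. *)
Let addVx : left_inverse e (fun a => m (ag_inv G a) e) add.
Proof.
by move=> a; rewrite /add meK; case/AG_groupP: AG => _ _ /(_ a)[[]].
Qed.

Let U : Type := additive_of AG.
HB.instance Definition _ := Finite.copy (additive_of AG) T.
HB.instance Definition _ :=
  Finite_isGroup.Build (additive_of AG) addA add1x addVx.

Let mulUE (a b : U) : a * b = add a b.
Proof. by []. Qed.

Lemma AG_group_isog_twist :
  exists (gT : finGroupType) (s : gT -> gT),
    [/\ #|gT| = #|T|, involutory_aut s & AG_isog (twist s) G].
Proof.
pose s (a : U) : U := m a e.
have autS : involutory_aut s.
  split=> [|a b|a]; last exact: meK.
    by apply/centsP=> a _ b _; apply: addC.
  by rewrite /s !mulUE add_e /add meK mCA.
have idM a b : ag_mul (twist s) a b = ag_mul G a b.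
  by rewrite twistM; congr (m _ b); apply: meK.
exists U, s; split=> //.
  by apply: (bij_eq_card (f := id : U -> T)); exists id.
apply/AG_isogP; exists id; split=> // [|a].
  by exists id.
(* Products and units agree, so the inverse in the twist is also an inverse in [G], and uniqueness
   identifies the two. *)
have /AG_groupP[_ _ /(_ a)[]] := AG_group_twist autS.
by rewrite !idM => h _; case/AG_groupP: AG => _ _ /(_ a)[_ /(_ _ h)].
Qed.

End Reduction.

(** * Isomorphisms of twists and their invariants *)

Lemma twist_isogI (gT hT : finGroupType) (s : gT -> gT) (t : hT -> hT)
    (f : gT -> hT) :
    bijective f -> {morph f : x y / x * y} -> (forall x, f (s x) = t (f x)) ->
  AG_isog (twist s) (twist t).
Proof.
move=> fb fM fs; have f1 : f 1 = 1 by apply: (mulgI (f 1)); rewrite -fM !mulg1.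
have fV x : f x^-1 = (f x)^-1 by apply: (mulgI (f x)); rewrite -fM !mulgV.
apply/AG_isogP; exists f; split=> // [x y|x].
  by rewrite !twistM fM fs.
by rewrite /ag_inv !ffunE fV fs.
Qed.

(* The twist is recovered from the AG-group as [s x = x . e]. *)
Lemma twist_isogE (gT hT : finGroupType) (s : gT -> gT) (t : hT -> hT) :
    involutory_aut s -> AG_isog (twist s) (twist t) ->
  exists f : gT -> hT,
    [/\ bijective f, {morph f : x y / x * y} & forall x, f (s x) = t (f x)].
Proof.
move=> [_ _ sK] /AG_isogP[f [fb fM _ f1]].
have fs x : f (s x) = t (f x).
  by have := fM x (1 : gT); rewrite !twistM f1 !mulg1.
exists f; split=> // x y.
by have := fM (s x) y; rewrite !twistM sK -fs sK.
Qed.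

Lemma bij_morph_isog (gT hT : finGroupType) (f : gT -> hT) :
  bijective f -> {morph f : x y / x * y} -> [set: gT] \isog [set: hT].
Proof.
move=> fb fM; have fM' : {in [set: gT] &, {morph f : x y / x * y}}.
  by move=> x y _ _; apply: fM.
apply/isogP; exists (Morphism fM').
  by apply/injmP=> x y _ _; apply: bij_inj.
apply/setP=> y; rewrite inE; case: fb => g _ gK.
by apply/morphimP; exists (g y); rewrite ?inE //= gK.
Qed.

Lemma isog_bij_morph (gT hT : finGroupType) :
    [set: gT] \isog [set: hT] ->
  exists2 f : gT -> hT, bijective f & {morph f : x y / x * y}.
Proof.
move=> iso; have [f f_inj _] := isogP iso.
exists f; last by move=> x y; rewrite morphM ?inE.
apply: inj_card_bij => [x y /(injmP f_inj)|]; first by apply; rewrite inE.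
by have := card_isog iso; rewrite !cardsT => ->.
Qed.

Lemma twist_isog_id (gT hT : finGroupType) (s : gT -> gT) :
    s =1 id -> [set: gT] \isog [set: hT] ->
  AG_isog (twist s) (twist (@id hT)).
Proof.
move=> s1 /isog_bij_morph[f fb fM].
by apply: (twist_isogI fb fM) => x; rewrite s1.
Qed.

Lemma twist_isog_inv (gT hT : finGroupType) (s : gT -> gT) :
    (forall x, s x = x^-1) -> [set: gT] \isog [set: hT] ->
  AG_isog (twist s) (twist (fun x : hT => x^-1)).
Proof.
move=> s1 /isog_bij_morph[f fb fM]; apply: (twist_isogI fb fM) => x.
apply: (mulgI (f x)); rewrite -fM s1 !mulgV.
by apply: (mulgI (f 1)); rewrite -fM !mulg1.
Qed.

(** An isomorphism invariant that separates all the representatives listed below, so that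
    non-isomorphism becomes a comparison of booleans. *)
Definition twist_type (gT : finGroupType) (s : gT -> gT) : bool * bool * bool :=
  (cyclic [set: gT], [forall x, s x == x], [forall x, s x == x^-1]).

Lemma twist_type_isog (gT hT : finGroupType) (s : gT -> gT) (t : hT -> hT) :
    involutory_aut s -> AG_isog (twist s) (twist t) ->
  twist_type s = twist_type t.
Proof.
move=> autS /(twist_isogE autS)[f [fb fM fs]].
have fV x : f x^-1 = (f x)^-1.
  apply: (mulgI (f x)); rewrite -fM !mulgV.
  by apply: (mulgI (f 1)); rewrite -fM !mulg1.
have [g fK gK] := fb.
congr (_, _, _); first exact/isog_cyclic/(bij_morph_isog fb).
  apply/forallP/forallP => h x; last by rewrite -(inj_eq (bij_inj fb)) fs.
  by rewrite -[x]gK -fs (eqP (h _)).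
apply/forallP/forallP => h x; last by rewrite -(inj_eq (bij_inj fb)) fs fV.
by rewrite -[x]gK -fs -fV (eqP (h _)).
Qed.

Local Notation twist_rep s :=
  (Tagged (fun gT : finGroupType => gT -> gT) s).

(** Combines [num_AG_groups_size] with the reduction to twists. The conditions on the list are
    propositions, hence a conjunction built by [foldr]. *)
Lemma num_AG_groups_twist (n : nat)
    (r : seq {gT : finGroupType & gT -> gT}) :
    foldr (fun (x : {gT : finGroupType & gT -> gT}) P =>
             (#|{: tag x}| = n /\ involutory_aut (tagged x)) /\ P) True r ->
    uniq (map (fun x : {gT : finGroupType & gT -> gT} =>
                 twist_type (tagged x)) r) ->
    (forall (gT : finGroupType) (s : gT -> gT),
       #|{: gT}| = n -> involutory_aut s ->
       has (fun x : {gT : finGroupType & gT -> gT} =>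
              AG_isog (twist s) (twist (tagged x))) r) ->
  num_AG_groups n = size r.
Proof.
move=> rP rU rC.
pose F (x : {gT : finGroupType & gT -> gT}) : {T : finType & ag_data T} :=
  Tagged ag_data (twist (tagged x)).
rewrite -(size_map F); apply: num_AG_groups_size.
- elim: r rP {rU rC} => //= x r IHr [[cx ax] /IHr->].
  by rewrite cx eqxx AG_group_twist.
- elim: r rP rU {rC} => //= x r IHr [[_ ax] rP] /andP[xr /(IHr rP)->].
  rewrite andbT all_map all_predC; apply: contra xr => xr.
  rewrite -has_pred1 has_map; apply: sub_has xr => y /= xy.
  by rewrite eq_sym; apply/eqP/twist_type_isog.
move=> G /AG_group_isog_twist[gT [s [cT autS sG]]].
rewrite has_map; apply: sub_has (rC gT s _ autS) => [x /= sx|].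
  exact: AG_isog_trans (AG_isog_sym sx) sG.
by rewrite cT card_ord.
Qed.

(** * Model involutions: identity, inversion, partial inversion and swap *)

Lemma involutory_aut_id (gT : finGroupType) :
  abelian [set: gT] -> involutory_aut (@id gT).
Proof. by []. Qed.

Lemma involutory_aut_inv (gT : finGroupType) :
  abelian [set: gT] -> involutory_aut (fun x : gT => x^-1).
Proof.
move=> cG; split=> // [x y|x]; last exact: invgK.
by rewrite invMg; apply: (centsP cG); rewrite inE.
Qed.

Lemma extprod_abelian (gT hT : finGroupType) :
  abelian [set: gT] -> abelian [set: hT] -> abelian [set: gT * hT].
Proof.
move=> cG cH; apply/centsP=> -[x1 x2] _ [y1 y2] _.
congr (_, _); first by apply: (centsP cG); rewrite inE.
by apply: (centsP cH); rewrite inE.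
Qed.

Lemma involutory_aut_pair_inv (gT : finGroupType) :
  abelian [set: gT] -> involutory_aut (fun x : gT * gT => (x.1, x.2^-1)).
Proof.
move=> cG; split=> [|x y|[x1 x2]]; first exact: extprod_abelian.
  by congr (_, _); rewrite invMg; apply: (centsP cG); rewrite inE.
by rewrite /= invgK.
Qed.

Lemma involutory_aut_swap (gT : finGroupType) :
  abelian [set: gT] -> involutory_aut (fun x : gT * gT => (x.2, x.1)).
Proof. by move=> cG; split=> [|//|[]//]; apply: extprod_abelian. Qed.

Lemma abelian_Zp n : abelian [set: 'Z_n].
Proof. exact: FinRing.zmod_abelian. Qed.

Lemma card_Zn n : 1 < n -> #|{: 'Z_n}| = n.
Proof. by move=> n_gt1; rewrite card_ord Zp_cast. Qed.

Lemma cyclic_Zp n : cyclic [set: 'Z_n].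
Proof. by rewrite Zp_cycle cycle_cyclic. Qed.

(** * Abelian groups of order p^2 and coordinates on them *)

Section PrimeSquare.
Variable p : nat.
Hypothesis p_pr : prime p.

Lemma abelem_Zp2 : p.-abelem [set: 'Z_p * 'Z_p].
Proof.
have p_gt1 := prime_gt1 p_pr.
rewrite abelemE // extprod_abelian ?abelian_Zp //=.
apply/exponentP=> -[x y] _.
have Zp (z : 'Z_p) : z ^+ p = 1.
  by have := expg_cardG (in_setT z); rewrite cardsT card_Zn.
have X (n : nat) (u v : 'Z_p) : ((u, v) : 'Z_p * 'Z_p) ^+ n = (u ^+ n, v ^+ n).
  by elim: n => // n IHn; rewrite !expgS IHn.
by rewrite X !Zp.
Qed.

Lemma card_Zp2 : #|{: 'Z_p * 'Z_p}| = (p ^ 2)%N.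
Proof. by rewrite card_prod card_Zn ?prime_gt1. Qed.

Lemma Zp2_Ncyclic : ~~ cyclic [set: 'Z_p * 'Z_p].
Proof.
by rewrite (abelem_cyclic abelem_Zp2) cardsT card_Zp2 pfactorK.
Qed.

(** Orders of elements divide p^2, and an element of order p^2 would generate the group. *)
Lemma order_p2_abelem (gT : finGroupType) :
    #|{: gT}| = (p ^ 2)%N -> abelian [set: gT] -> ~~ cyclic [set: gT] ->
  p.-abelem [set: gT].
Proof.
move=> cT cG Ncyc; rewrite abelemE // cG; apply/exponentP=> x _; apply/eqP.
rewrite -order_dvdn.
have: #[x] %| p ^ 2 by rewrite -cT -cardsT order_dvdG ?inE.
case/(dvdn_pfactor _ _ p_pr) => -[|[|[|//]]] _ ox; rewrite ox ?dvd1n //.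
case/negP: Ncyc; apply/cyclicP; exists x; apply/eqP.
by rewrite eq_sym eqEcard subsetT cardsT cT -ox leqnn.
Qed.

Lemma order_p2_isog (gT : finGroupType) :
    #|{: gT}| = (p ^ 2)%N -> abelian [set: gT] ->
  if cyclic [set: gT] then [set: gT] \isog [set: 'Z_(p ^ 2)]
  else [set: gT] \isog [set: 'Z_p * 'Z_p].
Proof.
move=> cT cG; have p2_gt1 : 1 < p ^ 2 by rewrite (ltn_exp2l 0) ?prime_gt1.
case: ifPn => [cyc|Ncyc].
  by rewrite isog_cyclic_card // cyclic_Zp !cardsT cT card_Zn ?eqxx.
rewrite (isog_abelem_card _ (order_p2_abelem cT cG Ncyc)).
by rewrite abelem_Zp2 !cardsT card_Zp2 cT eqxx.
Qed.

(** The group law of ['Z_p] is addition mod p, so the exponent on the left is i + j reduced mod p,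
    the order of z. *)
Lemma expg_ZpM (gT : finGroupType) (z : gT) (i j : 'Z_p) :
  #[z] = p -> z ^+ (i * j)%g = z ^+ i * z ^+ j.
Proof.
move=> oz; rewrite -expgD -[RHS]expg_mod_order oz.
by congr (_ ^+ _); congr (_ %% _); apply: Zp_cast; apply: prime_gt1.
Qed.

Lemma expg_ZpV (gT : finGroupType) (z : gT) (i : 'Z_p) :
  #[z] = p -> z ^+ (i^-1)%g = z^-1 ^+ i.
Proof.
move=> oz; apply: (mulgI (z ^+ i)).
by rewrite -expg_ZpM // mulgV expgVn mulgV.
Qed.

Section Grid.
Variables (gT : finGroupType) (x y : gT).
Hypothesis cG : abelian [set: gT].
Hypotheses (ox : #[x] = p) (oy : #[y] = p) (tixy : <[x]> :&: <[y]> = 1).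
Hypothesis cT : #|{: gT}| = (p ^ 2)%N.

(** Coordinates for the internal direct product of <x> and <y>, with residues mod p as exponents. *)
Definition grid (u : 'Z_p * 'Z_p) : gT := x ^+ u.1 * y ^+ u.2.

Lemma gridM : {morph grid : u v / u * v}.
Proof.
move=> [u1 u2] [v1 v2]; rewrite /grid /= !expg_ZpM // -!mulgA; congr (_ * _).
by rewrite !mulgA; congr (_ * _); apply: (centsP cG); rewrite inE.
Qed.

Lemma grid_bij : bijective grid.
Proof.
have Zp1 := Zp_cast (prime_gt1 p_pr).
have ltp (i : 'Z_p) : i < p by have := ltn_ord i; rewrite [X in _ < X]Zp1.
have X (z : gT) (i j : 'Z_p) : #[z] = p -> z ^+ i = z ^+ j -> i = j.
  move=> oz /eqP; rewrite eq_expg_mod_order oz => /eqP.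
  by rewrite !modn_small ?ltp // => /val_inj.
apply: inj_card_bij => [[u1 u2] [v1 v2] /= E|]; last by rewrite cT card_Zp2.
(* Separating the powers of x from those of y gives an element of both <x> and <y>, hence 1. *)
have D : (x ^+ v1)^-1 * x ^+ u1 = y ^+ v2 * (y ^+ u2)^-1.
  by apply: (mulgI (x ^+ v1)); rewrite mulKVg mulgA -[_ * y ^+ v2]E /grid mulgK.
have D1 : (x ^+ v1)^-1 * x ^+ u1 = 1.
  apply/set1gP; rewrite -tixy inE {2}D.
  by rewrite !groupM ?groupV ?mem_cycle.
congr (_, _); [apply: (X x) | apply: (X y)] => //.
  by apply: (mulgI (x ^+ v1)^-1); rewrite D1 mulVg.
by apply: (mulIg (y ^+ u2)^-1); rewrite -D D1 mulgV.
Qed.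

End Grid.
End PrimeSquare.

(** * Involutions on groups of odd order *)

Lemma odd_invg_fix (gT : finGroupType) (x : gT) :
  odd #|{: gT}| -> x = x^-1 -> x = 1.
Proof.
move=> oT xV; apply/eqP; rewrite -order_eq1 -dvdn1.
(* The order of x is odd, as a divisor of the group order, and divides 2 because x = x^-1. *)
have /eqP <- : coprime #[x] 2.
  by rewrite coprimen2 (dvdn_odd _ oT) // -cardsT order_dvdG ?inE.
by rewrite dvdn_gcd dvdnn order_dvdn expgS expg1 {2}xV mulgV eqxx.
Qed.

Lemma odd_invg_moved (gT : finGroupType) :
  odd #|{: gT}| -> 1 < #|{: gT}| -> exists x : gT, x != x^-1.
Proof.
move=> oT; rewrite -cardsT cardG_gt1 => /trivgPn[x _ x1]; exists x.
by apply: contra x1 => /eqP/(odd_invg_fix oT)->.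
Qed.

(* Away from [id] and inversion, both eigenspaces of [s] are nontrivial:
   [a * s a] is fixed and [b * (s b)^-1] is inverted. They meet trivially
   because the order is odd. *)
Lemma odd_twist_mixed (gT : finGroupType) (s : gT -> gT) :
    involutory_aut s -> odd #|{: gT}| ->
    ~~ [forall x, s x == x] -> ~~ [forall x, s x == x^-1] ->
  exists x y, [/\ s x = x, s y = y^-1, x != 1, y != 1
                & <[x]> :&: <[y]> = 1].
Proof.
move=> autS oT /forallPn[b sb] /forallPn[a sa]; have [cG sM sK] := autS.
exists (a * s a), (b * (s b)^-1).
have sx : s (a * s a) = a * s a by rewrite sM sK (twist_mulC autS).
have sy : s (b * (s b)^-1) = (b * (s b)^-1)^-1.
  by rewrite sM (twistV autS) sK invMg invgK.
split=> //.
- by apply: contra sa => /eqP ax; apply/eqP/(mulgI a); rewrite ax mulgV.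
- apply: contra sb => /eqP bx; apply/eqP/esym/(mulIg (s b)^-1).
  by rewrite bx mulgV.
apply/trivgP/subsetP=> z /setIP[/cycleP[i zx] /cycleP[j zy]].
apply/set1P; apply: (odd_invg_fix oT).
by rewrite {2}zy -expgVn -sy -twistX // -zy zx twistX // sx.
Qed.

Lemma twist_isog_pair_inv p (gT : finGroupType) (s : gT -> gT) :
    prime p -> odd p -> #|{: gT}| = (p ^ 2)%N -> involutory_aut s ->
    ~~ [forall x, s x == x] -> ~~ [forall x, s x == x^-1] ->
  AG_isog (twist s) (twist (fun x : 'Z_p * 'Z_p => (x.1, x.2^-1))).
Proof.
move=> p_pr op cT autS sN1 sNV; have [cG _ _] := autS.
have oT : odd #|{: gT}| by rewrite cT oddX op orbT.
have [x [y [sx sy x1 y1 tixy]]] := odd_twist_mixed autS oT sN1 sNV.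
have dvp (z : gT) : z != 1 -> p %| #[z].
  rewrite -order_eq1.
  have: #[z] %| p ^ 2 by rewrite -cT -cardsT order_dvdG ?inE.
  by case/(dvdn_pfactor _ _ p_pr) => -[|k] _ -> // _; rewrite expnS dvdn_mulr.
(* By trivial intersection <x> * <y> has #[x] * #[y] elements. Both orders are at least p, so both
   equal p. *)
have le_p2 : #[x] * #[y] <= p * p.
  rewrite mulnn -cT -[#[x]]/#|<[x]>| -[#[y]]/#|<[y]>| -TI_cardMg //.
  exact: max_card.
have px := dvdn_leq (order_gt0 x) (dvp x x1).
have py := dvdn_leq (order_gt0 y) (dvp y y1).
have p_gt0 := prime_gt0 p_pr.
have ox : #[x] = p.
  apply/eqP; rewrite eqn_leq px andbT -(leq_pmul2r p_gt0).
  by apply: leq_trans le_p2; rewrite leq_mul2l py orbT.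
have oy : #[y] = p.
  apply/eqP; rewrite eqn_leq py andbT -(leq_pmul2l p_gt0).
  by apply: leq_trans le_p2; rewrite leq_mul2r px orbT.
apply: AG_isog_sym.
apply: (twist_isogI (f := grid x y)) => [||[i j]].
- exact: grid_bij.
- exact: gridM.
(* In these coordinates s sends x^i y^j to x^i y^-j. *)
have [_ sM _] := autS; rewrite /grid -[LHS]/(x ^+ i * y ^+ (j^-1)%g).
by rewrite sM !(twistX autS) sx sy expg_ZpV.
Qed.

(** * Involutions on groups of order 4 and 2 *)

Lemma twist_isog_swap (gT : finGroupType) (s : gT -> gT) :
    #|{: gT}| = 4 -> involutory_aut s ->
    ~~ cyclic [set: gT] -> ~~ [forall x, s x == x] ->
  AG_isog (twist s) (twist (fun x : 'Z_2 * 'Z_2 => (x.2, x.1))).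
Proof.
move=> cT autS Ncyc /forallPn[x sx]; have [cG sM sK] := autS.
have x1 : x != 1 by apply: contraNneq sx => ->; rewrite twist1.
have sx1 : s x != 1.
  by apply: contraNneq x1 => E; rewrite -[x]sK E twist1.
have ab2 := order_p2_abelem (isT : prime 2) cT cG Ncyc.
have o2 (z : gT) : z != 1 -> #[z] = 2.
  by apply: abelem_order_p ab2 _; rewrite inE.
(* <x> has prime order and x lies outside <s x> = {1, s x}; thus x and s x form a basis, which s
   swaps. *)
have tix : <[x]> :&: <[s x]> = 1.
  apply: prime_TIg; first by rewrite -orderE o2.
  by rewrite cycle_subG /= (cycle2g (o2 _ sx1)) !inE negb_or x1 eq_sym.
apply: AG_isog_sym.
apply: (twist_isogI (f := grid x (s x))) => [||[i j]].
- by apply: grid_bij; rewrite ?o2.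
- by apply: gridM; rewrite ?o2.
by rewrite /grid /= sM !(twistX autS) sK (twist_mulC autS).
Qed.

(** A generator x goes to some x^i with i^2 = 1 mod 4, so i is 1 or 3: the first makes s the
    identity, the second inversion. *)
Lemma twist_cyclic4 (gT : finGroupType) (s : gT -> gT) :
    #|{: gT}| = 4 -> involutory_aut s ->
    cyclic [set: gT] -> ~~ [forall x, s x == x] ->
  forall z, s z = z^-1.
Proof.
move=> cT autS /cyclicP[x Gx] sN1; have [cG sM sK] := autS.
have genx z : z \in <[x]> by rewrite -Gx inE.
have ox : #[x] = 4 by rewrite orderE -Gx cardsT.
suff sx : s x = x^-1.
  by move=> z; have /cycleP[i ->] := genx z; rewrite (twistX autS) sx expgVn.
have /cyclePmin[i] := genx (s x); rewrite ox => lti sx.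
have sE (j : nat) : s (x ^+ j) = x ^+ (i * j) by rewrite (twistX autS) sx expgM.
have: x ^+ (i * i) == x ^+ 1 by rewrite -sE -sx sK.
rewrite eq_expg_mod_order ox.
(* The congruence fails by computation for i = 0 and i = 2; the cases left are i = 1 and i = 3. *)
case: i lti sx {sE} => [|[|[|[|//]]]] // _ sx _.
  case/forallPn: sN1 => z; case/negP; have /cycleP[j ->] := genx z.
  by rewrite (twistX autS) sx expg1.
by rewrite sx; apply: (mulgI x); rewrite mulgV -expgS -ox expg_order.
Qed.

(** If s moved x, then 1, x and s x would be three distinct elements. *)
Lemma twist_id2 (gT : finGroupType) (s : gT -> gT) :
  #|{: gT}| = 2 -> involutory_aut s -> s =1 id.
Proof.
move=> cT autS x; have [_ _ sK] := autS.
apply/eqP/negPn/negP => sx.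
have x1 : x != 1 by apply: contraNneq sx => ->; rewrite twist1.
have sx1 : s x != 1 by apply: contraNneq x1 => E; rewrite -[x]sK E twist1.
have /card_uniqP/= cU : uniq [:: 1; x; s x].
  by rewrite /= !inE negb_or ![1 == _]eq_sym x1 sx1 eq_sym sx.
by have := max_card (mem [:: 1; x; s x]); rewrite cU cT.
Qed.

(** * The counts for p, p^2, 2 and 4 *)

Lemma forall_id_eq (gT : finGroupType) : [forall x : gT, id x == x].
Proof. exact/forallP. Qed.

Lemma odd_invg_moved_forall (gT : finGroupType) :
  odd #|{: gT}| -> 1 < #|{: gT}| -> [forall x : gT, x^-1 == x] = false.
Proof.
move=> oT /(odd_invg_moved oT)[x xV]; apply/forallP=> /(_ x).
by rewrite eq_sym (negPf xV).
Qed.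

Lemma num_AG_groups_odd_prime p :
  prime p -> odd p -> num_AG_groups p = 2.
Proof.
move=> p_pr op; have p_gt1 := prime_gt1 p_pr; have cZ := card_Zn p_gt1.
have abZ := abelian_Zp p.
apply: (num_AG_groups_twist
  (r := [:: twist_rep (@id 'Z_p);
            twist_rep (fun x : 'Z_p => x^-1)])).
- split; first by split.
  by split=> //; split=> //; apply: involutory_aut_inv.
- rewrite /= andbT inE /twist_type !xpair_eqE forall_id_eq.
  by rewrite odd_invg_moved_forall ?cZ // andbF.
move=> gT s cT autS /=; have [cG _ _] := autS.
have iso : [set: gT] \isog [set: 'Z_p].
  by rewrite isog_cyclic_card ?prime_cyclic ?cyclic_Zp ?cardsT ?cT ?cZ /=.
have [/forallP s1|sN1] := boolP [forall x, s x == x].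
  by rewrite (twist_isog_id _ iso) // => x; apply/eqP.
have [/forallP sV|sNV] := boolP [forall x, s x == x^-1].
  by rewrite (twist_isog_inv _ iso) ?orbT // => x; apply/eqP.
have oT : odd #|{: gT}| by rewrite cT.
have [x [y [_ _ x1 y1 tixy]]] := odd_twist_mixed autS oT sN1 sNV.
have ord (z : gT) : z != 1 -> #[z] = p.
  rewrite -order_eq1 => z1; apply/eqP; move: z1; apply/implyP.
  rewrite implyNb; have: #[z] %| p by rewrite -cT -cardsT order_dvdG ?inE.
  by case/primeP: p_pr => _ /[apply].
(* Here <x> * <y> would have p * p elements inside a group of order p. *)
have := max_card (mem (<[x]> * <[y]>)); rewrite TI_cardMg // cT.
by rewrite -!orderE !ord // leqNgt ltn_Pmulr ?prime_gt0.
Qed.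

Lemma num_AG_groups_odd_prime_sqr p :
  prime p -> odd p -> num_AG_groups (p ^ 2) = 5.
Proof.
move=> p_pr op; have p_gt1 := prime_gt1 p_pr.
have p2_gt1 : 1 < p ^ 2 by rewrite (ltn_exp2l 0).
have cC := card_Zn p2_gt1; have cE := card_Zp2 p_pr.
have abC := abelian_Zp (p ^ 2); have abZ := abelian_Zp p.
have abE := extprod_abelian abZ abZ.
have op2 : odd (p ^ 2) by rewrite oddX op orbT.
apply: (num_AG_groups_twist
  (r := [:: twist_rep (@id 'Z_(p ^ 2));
            twist_rep (fun x : 'Z_(p ^ 2) => x^-1);
            twist_rep (@id ('Z_p * 'Z_p)%type);
            twist_rep (fun x : ('Z_p * 'Z_p)%type => x^-1);
            twist_rep (fun x : ('Z_p * 'Z_p)%type => (x.1, x.2^-1))])).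
- split; first by split.
  split; first by split=> //; apply: involutory_aut_inv.
  split; first by split.
  split; first by split=> //; apply: involutory_aut_inv.
  by split=> //; split=> //; apply: involutory_aut_pair_inv.
(* With a different from -a, the partial inversion moves (1, a) and does not invert (a, 1); [1] is
   the residue 0 in these pairs. *)
- have [a aV] : exists a : 'Z_p, a != a^-1.
    by apply: odd_invg_moved; rewrite card_Zn.
  rewrite /= !inE /twist_type !xpair_eqE !forall_id_eq cyclic_Zp.
  rewrite (negPf (Zp2_Ncyclic p_pr)) !odd_invg_moved_forall ?cC ?cE //=.
  have -> : [forall x : 'Z_p * 'Z_p, (x.1, x.2^-1) == x] = false.
    by apply/forallP=> /(_ (1, a))/eqP/(congr1 snd)/esym/eqP; apply/negP.
  have -> : [forall x : 'Z_p * 'Z_p, (x.1, x.2^-1) == x^-1] = false.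
    by apply/forallP=> /(_ (a, 1))/eqP/(congr1 fst)/eqP; apply/negP.
  by have -> : [forall x : 'Z_p * 'Z_p, x^-1 == x^-1] by apply/forallP.
move=> gT s cT autS /=; have [cG _ _] := autS.
have := order_p2_isog p_pr cT cG; set cyc := cyclic _ => iso.
have [/forallP s1|sN1] := boolP [forall x, s x == x].
  have {}s1 x : s x = x by apply/eqP.
  by case: cyc iso => iso; [|do 2!(apply/orP; right)]; apply/orP; left;
     apply: twist_isog_id s1 iso.
have [/forallP sV|sNV] := boolP [forall x, s x == x^-1].
  have {}sV x : s x = x^-1 by apply/eqP.
  by case: cyc iso => iso; [|do 2!(apply/orP; right)];
     apply/orP; right;
     apply/orP; left; apply: twist_isog_inv sV iso.
by do 4!(apply/orP; right); apply/orP; left; apply: twist_isog_pair_inv.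
Qed.

Lemma num_AG_groups_2 : num_AG_groups 2 = 1%N.
Proof.
apply: (num_AG_groups_twist
  (r := [:: twist_rep (@id 'Z_2)])) => //.
  by split=> //; split; [apply: card_Zn | apply/involutory_aut_id/abelian_Zp].
move=> gT s cT autS /=; rewrite orbF.
apply: twist_isog_id; first exact: twist_id2.
by rewrite isog_cyclic_card ?prime_cyclic ?cyclic_Zp ?cardsT ?cT ?card_Zn.
Qed.

Lemma num_AG_groups_4 : num_AG_groups 4 = 4.
Proof.
have abC := abelian_Zp 4; have abZ := abelian_Zp 2.
have abE := extprod_abelian abZ abZ.
have cC : #|{: 'Z_4}| = 4 by apply: card_Zn.
have cE : #|{: 'Z_2 * 'Z_2}| = 4 by apply: (@card_Zp2 2).
(* On Z/2 x Z/2 inversion and partial inversion are both the identity, so only the swap joins the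
   identity there. *)
apply: (num_AG_groups_twist
  (r := [:: twist_rep (@id 'Z_4);
            twist_rep (fun x : 'Z_4 => x^-1);
            twist_rep (@id ('Z_2 * 'Z_2)%type);
            twist_rep (fun x : ('Z_2 * 'Z_2)%type => (x.2, x.1))])).
- split; first by split.
  split; first by split=> //; apply: involutory_aut_inv.
  split; first by split.
  by split=> //; split=> //; apply: involutory_aut_swap.
- rewrite /= !inE /twist_type !xpair_eqE !forall_id_eq !cyclic_Zp.
  rewrite (negPf (@Zp2_Ncyclic 2 isT)) /=.
  (* In Z/4 the residue 1 differs from its negative 3; below, the swap moves (0, 1). *)
  have -> : [forall x : 'Z_4, x^-1 == x] = false.
    by apply/forallP=> /(_ Zp1).
  have -> // : [forall x : 'Z_2 * 'Z_2, (x.2, x.1) == x] = false.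
  by apply/forallP=> /(_ (1, Zp1)).
move=> gT s cT autS /=; have [cG _ _] := autS.
have := @order_p2_isog 2 isT gT cT cG.
have [/forallP s1|sN1] := boolP [forall x, s x == x].
  have {}s1 x : s x = x by apply/eqP.
  by case: ifP => _ iso; [|do 2!(apply/orP; right)]; apply/orP; left;
     apply: twist_isog_id s1 iso.
case: ifPn => cyc iso; last first.
  by do 3!(apply/orP; right); apply/orP; left; apply: twist_isog_swap.
apply/orP; right; apply/orP; left.
exact: twist_isog_inv (twist_cyclic4 cT autS cyc sN1) iso.
Qed.

Close Scope group_scope.

Theorem proposition3p2 :
  (forall p : nat, prime p -> 2 < p ->
     num_AG_groups p = 2 /\ num_AG_groups (p ^ 2) = 5) /\
  num_AG_groups 2 = 1 /\ num_AG_groups 4 = 4.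
Proof.
split; last by split; [apply: num_AG_groups_2 | apply: num_AG_groups_4].
move=> p p_pr p_gt2.
have op : odd p by case: (even_prime p_pr) p_gt2 => // ->.
by split; [apply: num_AG_groups_odd_prime | apply: num_AG_groups_odd_prime_sqr].
Qed.
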